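(* Let $G$ be a countably infinite amenable group, let $\mathcal{A}$ be a finite alphabet, and let $\mathcal{F}\subseteq\mathcal{A}^+_G$ be any set of patterns. Then the global growth and the local growth coincide: $$\alpha(\mathcal{F})=\tilde\alpha(\mathcal{F}).$$
   Context: A pattern over $G$ is an element $p\in\mathcal{A}^S$ where $S\subseteq G$ is a non-empty finite set, called its support $\operatorname{supp}(p)$; $\mathcal{A}^+_G$ is the set of all patterns. A pattern $f$ appears in a configuration $x\in\mathcal{A}^G$ if there is $g\in G$ with $x(gs)=f(s)$ for all $s\in\operatorname{supp}(f)$; it appears in a pattern $p\in\mathcal{A}^S$ if there is $g\in G$ with $g\cdot\operatorname{supp}(f)\subseteq S$ and $p(gs)=f(s)$ for all $s\in\operatorname{supp}(f)$. ''Avoids'' means ''does not appear in''. $X_{\mathcal{F}}$ is the set of configurations $x\in\mathcal{A}^G$ avoiding every $f\in\mathcal{F}$. For finite $S\subseteq G$, $\mathcal{G}_{\mathcal{F}}^{(S)}$ is the set of globally admissible patterns of support $S$, i.e. those $p\in\mathcal{A}^S$ that appear in some $x\in X_{\mathcal{F}}$, and $\mathcal{L}_{\mathcal{F}}^{(S)}$ is the set of locally admissible patterns of support $S$, i.e. those $p\in\mathcal{A}^S$ that avoid every $f\in\mathcal{F}$. Define $\mathbf{G}^{(n)}_{\mathcal{F}}=\min_{S\subseteq G,|S|=n}|\mathcal{G}_{\mathcal{F}}^{(S)}|$ and $\mathbf{L}^{(n)}_{\mathcal{F}}=\min_{S\subseteq G,|S|=n}|\mathcal{L}_{\mathcal{F}}^{(S)}|$,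 and $\alpha(\mathcal{F})=\lim_{n\to\infty}(\mathbf{G}^{(n)}_{\mathcal{F}})^{1/n}$ (global growth), $\tilde\alpha(\mathcal{F})=\lim_{n\to\infty}(\mathbf{L}^{(n)}_{\mathcal{F}})^{1/n}$ (local growth); both limits exist. *)

(* Defs.v *)
From HB Require Import structures.
From mathcomp Require Import all_boot all_order all_algebra finmap.
From mathcomp Require Import zify.
From mathcomp Require Import all_classical all_reals all_analysis.
Import Order.TTheory GRing.Theory Num.Theory.
Import numFieldNormedType.Exports.

Set Implicit Arguments.
Unset Strict Implicit.
Unset Printing Implicit Defensive.

Local Open Scope classical_set_scope.
Local Open Scope ring_scope.

Section Amenable.
Variables (R : realType) (G : groupType).

Definition translate (g : G) (S : {fset G}) : {fset G} :=
  [fset (g * s)%g | s in S]%fset.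

Definition symdiff (S T : {fset G}) : {fset G} :=
  ((S `\` T) `|` (T `\` S))%fset.

(* A sequence of non-empty finite subsets of [G], asymptotically invariant
   under left translations. *)
Definition Folner_sequence (E : nat -> {fset G}) : Prop :=
  (forall n, E n != fset0) /\
  (forall g : G,
     (fun n => #|` symdiff (translate g (E n)) (E n)|%:R / #|` E n|%:R : R)
       @ \oo --> (0 : R)).

(* For a countable discrete group, amenability is the existence of a (left)
   Folner sequence. *)
Definition amenable : Prop := exists E, Folner_sequence E.

End Amenable.

Section Subshift.
Variables (G : groupType) (A : finType).

(* A pattern of support [S] is a finite map [p] with [domf p = S]; a pattern in
   A^S is also given by [p : {ffun S -> A}], and [FinMap p] is then the finite
   map of domain [S]. *)
Definition patterns : set {fmap G -> A} := [set p | domf p != fset0].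

Definition appears_conf (f : {fmap G -> A}) (x : G -> A) : Prop :=
  exists g : G, forall s : domf f, x (g * fsval s)%g = f s.

(* [p.[? h] = Some a] means that [h] is in the support of [p] and [p h = a], so
   that the inclusion of [g * supp f] in [supp p] is part of the condition. *)
Definition appears_pat (f p : {fmap G -> A}) : Prop :=
  exists g : G, forall s : domf f, p.[? (g * fsval s)%g]%fmap = Some (f s).

Variable F : set {fmap G -> A}.

Definition subshift : set (G -> A) :=
  [set x | forall f, F f -> ~ appears_conf f x].

Definition globally_admissible (p : {fmap G -> A}) : Prop :=
  exists2 x, subshift x & appears_conf p x.

Definition locally_admissible (p : {fmap G -> A}) : Prop :=
  forall f, F f -> ~ appears_pat f p.

Definition glob_patterns (S : {fset G}) : {set {ffun S -> A}} :=
  finset (fun p : {ffun S -> A} => `[< globally_admissible (FinMap p) >]).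

Definition loc_patterns (S : {fset G}) : {set {ffun S -> A}} :=
  finset (fun p : {ffun S -> A} => `[< locally_admissible (FinMap p) >]).

End Subshift.

(* The least element of a set of natural numbers ([0] if the set is empty). *)
Definition natmin (N : set nat) : nat :=
  xget 0%N [set n | N n /\ forall m, N m -> (n <= m)%N].

Section Growth.
Variables (G : groupType) (A : finType) (F : set {fmap G -> A}).

Definition Gmin (n : nat) : nat :=
  natmin [set #|glob_patterns F S| | S in [set S : {fset G} | #|` S| = n]].

Definition Lmin (n : nat) : nat :=
  natmin [set #|loc_patterns F S| | S in [set S : {fset G} | #|` S| = n]].

End Growth.

(* The sequence [u n ^ (1 / n)]; its value at [n = 0], irrelevant for the
   limit, is 1 since [0^-1 = 0]. *)
Definition root_seq (R : realType) (u : nat -> nat) : R^nat :=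
  fun n => (u n)%:R `^ (n%:R^-1).

(* [limn] is a total operator, meaningful only for convergent sequences; both
   sequences below do converge when [G] is infinite, see [Gmin_cvg] and
   [Lmin_cvg]. *)
Definition global_growth (R : realType) (G : groupType) (A : finType)
  (F : set {fmap G -> A}) : R := limn (root_seq R (Gmin F)).

Definition local_growth (R : realType) (G : groupType) (A : finType)
  (F : set {fmap G -> A}) : R := limn (root_seq R (Lmin F)).

Lemma natminP (N : set nat) : N !=set0 ->
  N (natmin N) /\ forall m, N m -> (natmin N <= m)%N.
Proof.
move=> [k Nk]; rewrite /natmin.
have ex : exists n, `[< N n >] by exists k; apply/asboolP.
apply: (xgetPex 0%N (P := [set n | N n /\ forall m, N m -> (n <= m)%N])).
exists (ex_minn ex).
by case: ex_minnP => m /asboolP Nm mmin; split=> // l Nl; apply/mmin/asboolP.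
Qed.

Section FiniteSets.
Variable G : groupType.
Hypothesis Ginf : infinite_set [set: G].

Lemma ex_fset_card n : exists S : {fset G}, #|` S| = n.
Proof.
have [S _ nS] := infinite_set_fset n Ginf.
exists [fset x in take n S]%fset; rewrite card_fseq undup_id ?take_uniq //.
by rewrite size_takel.
Qed.

Lemma mem_translate g (S : {fset G}) h :
  (h \in translate g S) = ((g^-1 * h)%g \in S).
Proof.
apply/imfsetP/idP => /= [[s sS ->]|hS]; first by rewrite mulKg.
by exists (g^-1 * h)%g => //; rewrite mulVKg.
Qed.

Lemma card_translate g (S : {fset G}) : #|` translate g S| = #|` S|.
Proof. by rewrite card_imfset //=; apply: mulgI. Qed.

Lemma ex_translate_disjoint (S T : {fset G}) :
  exists g, [disjoint S & translate g T]%fset.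
Proof.
pose D : {fset G} := [fset (s * t^-1)%g | s in S, t in T]%fset.
have [g gST] : exists g, g \notin D.
  apply: contrapT => /forallNP allST; apply: Ginf; apply/finite_fsetP.
  by exists D; apply/seteqP; split=> // g _ /=; apply/negPn/negP/allST.
exists g; apply/fdisjointP => s sS; apply/negP; rewrite mem_translate => tT.
move/negP: gST; apply; apply/imfset2P; exists s => //.
by exists (g^-1 * s)%g => //; rewrite invgM invgK mulVKg.
Qed.

End FiniteSets.

Section Appears.
Variables (G : groupType) (A : finType).
Implicit Types (f p q : {fmap G -> A}) (x : G -> A).

Lemma appears_pat_trans q f p :
  appears_pat f q -> appears_pat q p -> appears_pat f p.
Proof.
move=> [g fq] [h qp]; exists (h * g)%g => s.
move: (fq s); case: fndP => // gsq [<-].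
by rewrite -mulgA (qp [` gsq]%fset).
Qed.

Lemma appears_pat_conf q f x :
  appears_pat f q -> appears_conf q x -> appears_conf f x.
Proof.
move=> [g fq] [h qx]; exists (h * g)%g => s.
move: (fq s); case: fndP => // gsq [<-].
by rewrite -mulgA (qx [` gsq]%fset).
Qed.

End Appears.

Section Submultiplicative.
Variables (G : groupType) (A : finType) (Q : {fmap G -> A} -> Prop).
Hypothesis Ginf : infinite_set [set: G].
Hypothesis Qsub : forall f p, appears_pat f p -> Q p -> Q f.

Let cnt (S : {fset G}) : {set {ffun S -> A}} :=
  finset (fun p : {ffun S -> A} => `[< Q (FinMap p) >]).
Let mincnt n := natmin [set #|cnt S| | S in [set S : {fset G} | #|` S| = n]].

Let mincntP n : exists S : {fset G}, #|` S| = n /\ #|cnt S| = mincnt n.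
Proof.
have [S Sn] := ex_fset_card Ginf n.
have [|[T Tn eT] _] := @natminP
  [set #|cnt S| | S in [set S : {fset G} | #|` S| = n]].
  by exists #|cnt S|; exists S.
by exists T; split.
Qed.

Let mincnt_le (S : {fset G}) : (mincnt #|` S| <= #|cnt S|)%N.
Proof.
have [|_] := @natminP [set #|cnt T| | T in [set T : {fset G} | #|` T| = #|` S|]].
  by exists #|cnt S|; exists S.
by apply; exists S.
Qed.

Let cnt_sub g (S U : {fset G}) (SU : forall s : S, (g * fsval s)%g \in U)
    (p : {ffun U -> A}) :
  p \in cnt U -> [ffun s : S => p [` SU s]%fset] \in cnt S.
Proof.
rewrite !inE; apply: Qsub.
exists g => s /=; case: fndP => [gsU|]; last by rewrite SU.
by rewrite ffunE; congr (Some (p _)); apply: val_inj.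
Qed.

Let cntU g (S T : {fset G}) :
  (#|cnt (S `|` translate g T)%fset| <= #|cnt S| * #|cnt T|)%N.
Proof.
set U := (S `|` translate g T)%fset.
have SU (s : S) : (1 * fsval s)%g \in U by rewrite mul1g inE fsvalP.
have TU (t : T) : (g * fsval t)%g \in U.
  by rewrite inE mem_translate mulKg fsvalP orbT.
rewrite -cardsX.
pose h (p : {ffun U -> A}) :=
  ([ffun s : S => p [` SU s]%fset], [ffun t : T => p [` TU t]%fset]).
have hinj : injective h.
  move=> p q [/ffunP e1 /ffunP e2]; apply/ffunP => -[u uU].
  have /fsetUP[uS|] := uU.
    have := e1 [` uS]%fset; rewrite !ffunE => e.
    by rewrite (_ : FSetSub uU = [` SU [` uS]%fset]%fset) //;
      apply: val_inj; rewrite /= mul1g.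
  rewrite mem_translate => uT.
  have := e2 [` uT]%fset; rewrite !ffunE => e.
  by rewrite (_ : FSetSub uU = [` TU [` uT]%fset]%fset) //;
    apply: val_inj; rewrite /= mulVKg.
rewrite -(card_imset _ hinj); apply/subset_leq_card/fintype.subsetP => _ /imsetP[p pU ->].
by rewrite inE !cnt_sub.
Qed.

(* This covers both [Gmin] and [Lmin]: global and local admissibility are each
   inherited by the patterns appearing in an admissible one. *)
Lemma submul m n : (mincnt (m + n) <= mincnt m * mincnt n)%N.
Proof.
have [S [Sm <-]] := mincntP m; have [T [Tn <-]] := mincntP n.
have [g dST] := ex_translate_disjoint Ginf S T.
apply: leq_trans (cntU g S T).
rewrite (_ : (m + n)%N = #|` S `|` translate g T|%fset) ?mincnt_le //.
have /eqP ST0 : (S `&` translate g T == fset0)%fset by rewrite fsetI_eq0.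
by rewrite cardfsU ST0 cardfs0 subn0 card_translate Sm Tn.
Qed.

End Submultiplicative.

Section Fekete.
Variables (R : realType) (v : nat -> nat).
Hypothesis vM : forall m n, (v (m + n) <= v m * v n)%N.
Let u := root_seq R v.
Let C := maxn 1 (v 1).

Let v_add m k : (v (m + k) <= v m * C ^ k)%N.
Proof.
elim: k => [|k IH]; first by rewrite addn0 expn0 muln1.
rewrite addnS -addn1 (leq_trans (vM _ _)) // expnSr mulnA leq_mul //.
exact: leq_maxr.
Qed.

Let v_mul m q : (v (q.+1 * m) <= v m ^ q.+1)%N.
Proof.
elim: q => [|q IH]; first by rewrite mul1n expn1.
by rewrite mulSn (leq_trans (vM _ _)) // [leqRHS]expnS leq_mul.
Qed.

Let u_ge0 n : 0 <= u n. Proof. exact: powR_ge0. Qed.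

Let u_le m n : (0 < m <= n)%N -> (0 < v m)%N ->
  u n <= u m * C%:R `^ (m%:R / n%:R).
Proof.
move=> /andP[m0 mn] vm0.
have n0 : (0 < n)%N by lia.
have q0 : (0 < n %/ m)%N by rewrite divn_gt0.
have vn : (v n <= v m ^ (n %/ m) * C ^ m)%N.
  rewrite {1}(divn_eq n m) (leq_trans (v_add _ _)) // leq_mul //.
    by rewrite -(prednK q0) v_mul.
  by rewrite leq_pexp2l ?leq_maxl // ltnW // ltn_mod.
have nV0 : 0 <= (n%:R : R)^-1 by rewrite invr_ge0.
have vm1 : 1 <= (v m)%:R :> R by rewrite ler1n.
apply: (@le_trans _ _ ((v m ^ (n %/ m) * C ^ m)%:R `^ (n%:R^-1))).
  by apply: ge0_ler_powR => //; rewrite ?nnegrE ?ler0n ?ler_nat.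
rewrite natrM !natrX powRM ?exprn_ge0 // -!powR_mulrn // -!powRrM.
rewrite ler_wpM2r ?powR_ge0 // ler_powR //.
rewrite ler_pdivrMr ?ltr0n // mulrC ler_pdivlMr ?ltr0n //.
by rewrite -natrM ler_nat leq_divM.
Qed.

Let C_cvg m : (C%:R `^ (m%:R / n%:R) : R) @[n --> \oo] --> (1 : R).
Proof.
have C0 : (C%:R : R) != 0 by rewrite pnatr_eq0 -lt0n leq_max.
have -> : (fun n => (C%:R `^ (m%:R / n%:R) : R))
    = (fun n => expR (m%:R / n%:R * ln C%:R)).
  by apply/funext => n; rewrite /powR (negPf C0).
have V0 : (n%:R^-1 : R) @[n --> \oo] --> (0 : R).
  by rewrite -(cvg_shiftS (fun n => (n%:R : R)^-1)); exact: cvg_harmonic.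
have L0 : (m%:R / n%:R * ln (C%:R : R)) @[n --> \oo] --> (0 : R).
  rewrite -(mul0r (ln (C%:R : R))) -(mulr0 (m%:R : R)).
  by apply: cvgM; [apply: cvgM => //|]; exact: cvg_cst.
suff : (expR (m%:R / n%:R * ln (C%:R : R))) @[n --> \oo] --> expR (0 : R).
  by rewrite expR0.
by apply: continuous_cvg => //; exact: continuous_expR.
Qed.

Lemma fekete : cvgn u.
Proof.
have [[m vm0]|v_pos] := pselect (exists m, v m = 0%N).
  apply/cvg_ex; exists 0; apply: cvg_near_cst.
  near=> n.
  have /subnKC nE : (m <= n)%N by near: n; exact: nbhs_infty_ge.
  have n0 : (0 < n)%N by near: n; exact: nbhs_infty_gt.
  have vn : v n = 0%N.
    by have := v_add m (n - m); rewrite nE vm0 mul0n leqn0 => /eqP.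
  by rewrite /u /root_seq vn powR0 // invr_neq0 // pnatr_eq0 -lt0n.
have vpos m : (0 < v m)%N.
  by rewrite lt0n; apply/eqP => vm; apply: v_pos; exists m.
pose E := [set u m | m in [set m | (0 < m)%N]].
have E1 : E !=set0 by exists (u 1%N); exists 1%N.
have Elb : has_lbound E by exists 0 => _ [m _ <-].
apply/cvg_ex; exists (inf E); apply/cvgrPdist_le => e e0.
have [_ [m m0 <-] um] : exists2 x, E x & x < inf E + e.
  exact: inf_adherent.
have u_lt := cvgr_lt _ (cvgMl_tmp (a := u m) (@C_cvg m)) (inf E + e).
near=> n.
have n0 : (0 < n)%N by near: n; exact: nbhs_infty_gt.
have mn : (m <= n)%N by near: n; exact: nbhs_infty_ge.
have infu : inf E <= u n by apply: ge_inf => //; exists n.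
rewrite ler0_norm ?subr_le0 // opprB lerBlDl ltW //.
apply: le_lt_trans (u_le (n := n) _ (vpos m)) _; first by rewrite m0.
by near: n; apply: u_lt; rewrite mulr1.
Unshelve. all: by end_near. Qed.
End Fekete.


Lemma Gmin_cvg (R : realType) (G : groupType) (A : finType)
    (F : set {fmap G -> A}) : infinite_set [set: G] ->
  cvgn (root_seq R (Gmin F)).
Proof.
move=> Ginf; apply: fekete; apply: submul => // f p fp [x xF px].
by exists x => //; exact: appears_pat_conf fp px.
Qed.

Lemma Lmin_cvg (R : realType) (G : groupType) (A : finType)
    (F : set {fmap G -> A}) : infinite_set [set: G] ->
  cvgn (root_seq R (Lmin F)).
Proof.
move=> Ginf; apply: fekete; apply: submul => // f p fp pF h hF hf.
exact: pF hF (appears_pat_trans hf fp).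
Qed.

(* Main.v *)
Require Import Defs.
From HB Require Import structures.
From mathcomp Require Import all_boot all_order all_algebra finmap.
From mathcomp Require Import all_classical all_reals all_analysis.
Import Order.TTheory GRing.Theory Num.Theory.
Import numFieldNormedType.Exports.

(* Globally admissible patterns are locally admissible, whence one inequality.
   For the other, fix a finite non-empty set S.  By compactness there is a
   finite set T containing S such that the restriction to S of a locally
   admissible pattern on T is globally admissible.  Let E be the inverse of a
   Folner set.  The translates gS meeting E cover each point of E exactly |S|
   times, and for all but o(|E|) of them gT is contained in E, so that a locally
   admissible pattern on E is globally admissible on gS.  Shearer's inequality
   then bounds the number of locally admissible patterns on E by
   |G^(S)|^(|E| / |S|) |A|^(o(|E|)); no tiling of the group is needed. *)

Set Implicit Arguments.
Unset Strict Implicit.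
Unset Printing Implicit Defensive.

Local Open Scope classical_set_scope.
Local Open Scope ring_scope.

(** * Hölder's inequality for finite sums *)

Lemma powR_invn_expr (R : realType) (x : R) k :
  0 <= x -> (0 < k)%N -> (x `^ k%:R^-1) ^+ k = x.
Proof.
move=> x0 k0; rewrite -powR_mulrn ?powR_ge0 // -powRrM mulVf ?powRr1 //.
by rewrite pnatr_eq0 -lt0n.
Qed.

(** Dividing each [x i] by its total [X i] makes every family sum to 1; AM-GM bounds the geometric
    mean of the normalised terms at [t] by their average, and these averages sum to 1. If some [X i]
    vanishes, so does every [c t]. *)
Lemma holder_sum_prod (R : realType) (T I : finType) (J : {set I})
    (c : T -> R) (x : I -> T -> R) :
  (0 < #|J|)%N -> (forall t, 0 <= c t) -> (forall i t, 0 <= x i t) ->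
  (forall t, c t ^+ #|J| <= \prod_(i in J) x i t) ->
  (\sum_t c t) ^+ #|J| <= \prod_(i in J) \sum_t x i t.
Proof.
set k := #|J| => k0 c0 x0 cx.
pose X i := \sum_t x i t.
have X0 i : 0 <= X i by apply: sumr_ge0.
have [/existsP[i /andP[iJ /eqP Xi]]|/existsPn noX] :=
  boolP [exists i, (i \in J) && (X i == 0)].
  have c_eq0 t : c t = 0.
    have /eqP := Xi; rewrite psumr_eq0 // => /allP/(_ t).
    rewrite mem_index_enum => /(_ isT)/eqP xt.
    have := cx t; rewrite (bigD1 i) //= xt mul0r => ct0.
    have : c t ^+ k == 0 by rewrite eq_le ct0 exprn_ge0.
    by rewrite expf_eq0 => /andP[_ /eqP].
  rewrite big1 => [|t _]; last exact: c_eq0.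
  by rewrite expr0n (gtn_eqF k0) prodr_ge0 // => j _; exact: X0.
have Xp i : i \in J -> 0 < X i.
  by move=> iJ; rewrite lt_def X0 andbT; have := noX i; rewrite iJ.
pose P := \prod_(i in J) X i.
have P0 : 0 < P by apply: prodr_gt0 => i /Xp.
pose r := P `^ (k%:R^-1).
have r0 : 0 < r by rewrite powR_gt0.
have rk : r ^+ k = P by rewrite powR_invn_expr // ltW.
rewrite -[leRHS]/P -rk ler_pXn2r ?nnegrE ?(ltW r0) ?sumr_ge0 //.
suff ct t : c t <= r * ((\sum_(i in J) x i t / X i) / k%:R).
  apply: le_trans (ler_sum _ (fun t _ => ct t)) _.
  rewrite -mulr_sumr -mulr_suml exchange_big /=.
  rewrite (eq_bigr (fun=> 1)) => [|i iJ]; last first.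
    by rewrite -mulr_suml divff // gt_eqF // Xp.
  by rewrite sumr_const -/k divff ?mulr1 // pnatr_eq0 -lt0n.
have q0 i : 0 <= x i t / X i by rewrite divr_ge0.
have s0 : 0 <= \sum_(i in J) x i t / X i by exact: sumr_ge0.
rewrite -(@ler_pXn2r _ k) ?nnegrE ?mulr_ge0 ?invr_ge0 ?(ltW r0) //.
rewrite exprMn rk.
have := leif_AGM (A := J) (E := fun i => x i t / X i) (fun i _ => q0 i).
move=> /= [+ _]; rewrite -/k => agm.
apply: le_trans (ler_wpM2l (ltW P0) agm).
rewrite -big_split /= (le_trans (cx t)) // ler_prod // => i iJ.
by rewrite x0 mulrCA divff ?mulr1 //= gt_eqF // Xp.
Qed.

(** * Shearer's inequality for projections *)

Section Shearer.
Variables (V A : finType).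
Implicit Types (F : {set {ffun V -> A}}) (D : {set V}).

(* [None] outside of [D], so that projections to different sets share a type. *)
Definition restrict_to D (f : {ffun V -> A}) : {ffun V -> option A} :=
  [ffun v => if v \in D then Some (f v) else None].

Lemma restrict_toP D (f g : {ffun V -> A}) :
  restrict_to D f = restrict_to D g <-> {in D, f =1 g}.
Proof.
split=> [/ffunP fg v vD|fg]; first by have := fg v; rewrite !ffunE vD => -[].
by apply/ffunP => v; rewrite !ffunE; case: ifP => // /fg ->.
Qed.

Lemma card_restrict_to_split F D v : v \in D ->
  #|restrict_to D @: F| =
  (\sum_a #|restrict_to (D :\ v) @: [set f in F | f v == a]%SET|)%N.
Proof.
move=> vD.
pose B a := [set p in restrict_to D @: F | p v == Some a]%SET.
have -> : #|restrict_to D @: F| = (\sum_a #|B a|)%N.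
  rewrite -sum1_card; under [RHS]eq_bigr do rewrite -sum1_card.
  rewrite (exchange_big_dep (mem (restrict_to D @: F))) /=; last first.
    by move=> a p _; rewrite inE => /andP[].
  apply: eq_bigr => _ /imsetP[f fF ->].
  rewrite (big_pred1 (f v)) // => a.
  by rewrite !inE imset_f //= ffunE vD eq_sym.
apply: eq_bigr => a _.
(* Erasing the coordinate [v] loses nothing on [B a], where the value at [v] is known. *)
pose er (p : {ffun V -> option A}) : {ffun V -> option A} :=
  [ffun w => if w == v then None else p w].
have erE f : er (restrict_to D f) = restrict_to (D :\ v) f.
  by apply/ffunP => w; rewrite !ffunE !inE; case: eqP.
have -> : (restrict_to (D :\ v) @: [set f in F | f v == a]%SET) = er @: B a.
  apply/setP => p; apply/imsetP/imsetP => [[f]|[q]].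
    rewrite inE => /andP[fF /eqP fa] ->.
    exists (restrict_to D f); last by rewrite erE.
    by rewrite inE imset_f //= ffunE vD fa.
  rewrite inE => /andP[/imsetP[f fF ->]]; rewrite ffunE vD => /eqP[fa] ->.
  by exists f; rewrite ?erE // inE fF fa eqxx.
rewrite card_in_imset // => p q.
rewrite !inE => /andP[_ /eqP pa] /andP[_ /eqP qa].
move=> /ffunP e; apply/ffunP => w; have := e w; rewrite !ffunE.
by case: eqP => [->|//]; rewrite pa qa.
Qed.

Lemma card_restrict_to_sub F F' D :
  F \subset F' -> (#|restrict_to D @: F| <= #|restrict_to D @: F'|)%N.
Proof. by move=> FF'; exact/subset_leq_card/imsetS. Qed.

(* Induction on [D]: removing the coordinate [v], the family splits according
   to the value at [v]; the factors with [v] in [S i] are recombined by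
   Hölder's inequality, and the others only decrease. *)
Lemma shearer (R : realType) (I : finType) (S : I -> {set V}) (k : nat) F D :
  (0 < k)%N -> (forall v, v \in D -> #|[set i | v \in S i]%SET| = k) ->
  (#|restrict_to D @: F| ^ k <= \prod_i #|restrict_to (S i :&: D) @: F|)%N.
Proof.
move=> k0; have [n] := ubnP #|D|; elim: n => // n IH in D F *.
have [->|[v vD]] := set_0Vmem D.
  move=> _ _; have [->|[f fF]] := set_0Vmem F.
    by rewrite imset0 cards0 exp0n.
  have -> : restrict_to finset.set0 @: F = [set restrict_to finset.set0 f]%SET.
    apply/setP => p; rewrite inE; apply/imsetP/eqP => [[g gF ->]|->].
      by apply/restrict_toP => w; rewrite inE.
    by exists f.
  rewrite cards1 exp1n prodn_gt0 // => i.
  apply/card_gt0P; exists (restrict_to (S i :&: finset.set0) f).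
  exact: imset_f.
move=> Dn covD.
pose Fa a := [set f in F | f v == a]%SET.
pose J := [set i | v \in S i]%SET.
have Jk : #|J| = k by exact: covD.
pose N i a := #|restrict_to (S i :&: (D :\ v)) @: Fa a|.
have IHa a : (#|restrict_to (D :\ v) @: Fa a| ^ k <= \prod_i N i a)%N.
  apply: IH => [|w]; last by rewrite inE => /andP[_ /covD].
  by move: Dn; rewrite (cardsD1 v) vD.
have NJ i : i \in J -> #|restrict_to (S i :&: D) @: F| = (\sum_a N i a)%N.
  rewrite inE => vS; rewrite (@card_restrict_to_split _ _ v) ?inE ?vS //.
  by apply: eq_bigr => a _; rewrite /N finset.setIDA.
pose M := (\prod_(i | i \notin J) #|restrict_to (S i :&: D) @: F|)%N.
have MN a : (\prod_(i | i \notin J) N i a <= M)%N.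
  apply: leq_prod => i; rewrite inE => vS; rewrite /N.
  have -> : S i :&: (D :\ v) = S i :&: D.
    by apply/setP => w; rewrite !inE; case: eqP => // ->; rewrite (negPf vS).
  by apply/card_restrict_to_sub/fintype.subsetP => f; rewrite inE => /andP[].
rewrite (card_restrict_to_split _ vD) (bigID (mem J)) /= -/M.
rewrite (eq_bigr (fun i => \sum_a N i a)%N) => [|i iJ]; last by rewrite NJ.
have [M0|Mp] := posnP M.
  rewrite M0 muln0 leqn0 expn_eq0 k0 andbT sum_nat_eq0; apply/forallP => a /=.
  have := IHa a; rewrite (bigID (mem J)) /=.
  have := MN a; rewrite M0 leqn0 => /eqP ->.
  by rewrite muln0 leqn0 expn_eq0 => /andP[].
(* Dividing by [r], the [k]-th root of [M], turns [IHa] into the hypothesis of Hölder's inequality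
   over the [k] indices in [J]. *)
pose r : R := M%:R `^ (k%:R^-1).
have r0 : 0 < r by rewrite powR_gt0 // ltr0n.
have rk : r ^+ k = M%:R by rewrite powR_invn_expr.
have := @holder_sum_prod R A I J
  (fun a => #|restrict_to (D :\ v) @: Fa a|%:R / r) (fun i a => (N i a)%:R).
rewrite Jk => /(_ k0) h.
rewrite -(ler_nat R) natrX natrM natr_sum natr_prod.
under [X in X * _]eq_bigr do rewrite natr_sum.
rewrite -ler_pdivrMr ?ltr0n // -rk -expr_div_n mulr_suml.
apply: h => // [a|a]; first by rewrite divr_ge0 // ltW.
rewrite expr_div_n rk ler_pdivrMr ?ltr0n // -natrX -natr_prod -natrM ler_nat.
by apply: leq_trans (IHa a) _; rewrite (bigID (mem J)) /= leq_mul.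
Qed.

End Shearer.

(** * Compactness and local admissibility *)

Section Patterns.
Variables (G : groupType) (A : finType) (F : set {fmap G -> A}).

Definition restr (y : G -> A) (S : {fset G}) : {fmap G -> A} :=
  FinMap [ffun s : S => y (fsval s)].

Lemma restr_fnd y S h :
  (restr y S).[? h]%fmap = if h \in S then Some (y h) else None.
Proof.
have [hS|hS] := boolP (h \in S); last by rewrite not_fnd.
by rewrite (in_fnd (hS : h \in domf (restr y S))) /restr ffunE.
Qed.

(** Convergence along the finite subsets of [G] directed by inclusion. *)
Let tails : set_system {fset G} :=
  [set P | exists T0, forall T, (T0 `<=` T)%fset -> P T].

#[local] Instance tails_filter : ProperFilter tails.
Proof.
split; first by move=> [T /(_ T (fsubset_refl T))].
split=> [|P Q [T hT] [U hU]|P Q PQ [T hT]].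
- by exists fset0.
- exists (T `|` U)%fset => W; rewrite fsubUset => /andP[TW UW].
  by split; [exact: hT | exact: hU].
- by exists T => W TW; apply/PQ/hT.
Qed.

(* Compactness of [G -> A]: counterexamples [y T] for all [T] would converge
   along an ultrafilter to a configuration of the subshift. *)
Lemma locally_globally_admissible (S : {fset G}) :
  exists2 T : {fset G}, (S `<=` T)%fset & forall y : G -> A,
    locally_admissible F (restr y T) -> globally_admissible F (restr y S).
Proof.
apply: contrapT => noT.
have /choice[y yT] : forall T : {fset G}, exists y : G -> A,
    locally_admissible F (restr y (S `|` T)%fset) /\
    ~ globally_admissible F (restr y S).
  move=> T; apply: contrapT => /forallNP noy; apply: noT.
  exists (S `|` T)%fset; first exact: fsubsetUl.
  by move=> y yl; apply: contrapT => yg; apply: (noy y).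
have [U [Uultra tailsU]] := ultraFilterLemma tails_filter.
have UP : ProperFilter U by exact: ultra_proper.
(* The alphabet is finite, so the ultrafilter selects one letter at each [g]. *)
have /choice[x xU] : forall g, exists a, U [set T | y T g = a].
  move=> g; apply: contrapT => /forallNP noa.
  have : U [set T | forall a, y T g <> a].
    apply: filter_forall => a.
    by have [/noa//|] := in_ultra_setVsetC [set T | y T g = a] Uultra.
  by move=> /filter_ex[T /(_ (y T g))].
(* A forbidden pattern in [x] involves finitely many cells; for [U]-many [T] these lie in [T] and
   [y T] agrees with [x] on them. *)
have xF : subshift F x.
  move=> f Ff [g xf].
  have Uf : U [set T | forall s : domf f, y T (g * fsval s)%g = f s].
    by apply: filter_forall => s; have := xU (g * fsval s)%g; rewrite xf.
  have Ug : U [set T | (translate g (domf f) `<=` T)%fset].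
    by apply: tailsU; exists (translate g (domf f)).
  have [T [Tf Tg]] := filter_ex (filterI Uf Ug).
  have [/(_ f Ff) yl _] := yT T; apply: yl; exists g => s.
  rewrite restr_fnd inE Tf.
  by rewrite (fsubsetP Tg) ?orbT // mem_translate mulKg fsvalP.
have US : U [set T | forall s : S, y T (fsval s) = x (fsval s)].
  by apply: filter_forall => s; exact: xU.
have [T TS] := filter_ex US; have [_] := yT T; apply; exists x => //.
by exists 1%g => s; rewrite mul1g /restr ffunE TS.
Qed.

(** * Counting locally admissible patterns on a finite set *)

Section Bound.
Variables (S T E : {fset G}).
Hypothesis S0 : S != fset0.
Hypothesis ST : (S `<=` T)%fset.
Hypothesis hT : forall y : G -> A,
  locally_admissible F (restr y T) -> globally_admissible F (restr y S).

(** These are the [g] for which [gS] meets [E]. *)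
Definition centers : {fset G} := [fset (e * s^-1)%g | e in E, s in S]%fset.

Definition exterior : {set centers} :=
  finset (fun i : centers => ~~ (translate (fsval i) T `<=` E)%fset).

(** The maximum keeps [C] positive for an empty alphabet, so that its powers tend to 1 as the
    exponent tends to 0. *)
Let C := maxn 1 #|A|.

Let trace (i : centers) : {set E} :=
  finset (fun v : E => ((fsval i)^-1 * fsval v)%g \in S).

(** The centers whose trace contains [v] are the distinct elements [v * s^-1], for [s] in [S]. *)
Let card_cover (v : E) : #|finset (fun i => v \in trace i)| = #|` S|.
Proof.
have vS (s : S) : (fsval v * (fsval s)^-1)%g \in centers.
  apply/imfset2P; exists (fsval v); rewrite ?fsvalP //.
  by exists (fsval s); rewrite ?fsvalP.
pose c (s : S) : centers := [` vS s]%fset.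
have cinj : injective c.
  by move=> s t [/mulgI/invg_inj]; exact: val_inj.
rewrite cardfE -cardsT -(card_imset _ cinj); congr #|pred_of_set _|.
apply/setP => i; rewrite !inE; apply/idP/imsetP => [iS|[s _ ->]].
  exists [` iS]%fset; rewrite ?inE //; apply: val_inj => /=.
  by rewrite invgM invgK mulVKg.
by rewrite /= invgM invgK mulgVK fsvalP.
Qed.

Let card_trace (i : centers) :
  (#|restrict_to (trace i) @: loc_patterns F E| <=
   if i \in exterior then C ^ #|` S| else #|glob_patterns F S|)%N.
Proof.
have [->|[f0 f0E]] := set_0Vmem (loc_patterns F E).
  by rewrite imset0 cards0.
(* A center exists, so [E] is non-empty; [v0] supplies the value of [y f] outside [E]. *)
have [v0 _] : exists v : E, true.
  have /imfset2P[e eE _] := fsvalP i; by exists [` eE]%fset.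
pose y (f : {ffun E -> A}) g := if insub g is Some v then f v else f v0.
have yE f (v : E) : y f (fsval v) = f v by rewrite /y valK.
pose q (f : {ffun E -> A}) := [ffun s : S => y f (fsval i * fsval s)%g].
pose h (p : {ffun S -> A}) : {ffun E -> option A} :=
  [ffun v => omap p (insub ((fsval i)^-1 * fsval v)%g)].
(* The projection depends only on the pattern [q f] read on [S] after translation by [i], so it
   suffices to count these. *)
have hq f : restrict_to (trace i) f = h (q f).
  apply/ffunP => v; rewrite !ffunE inE.
  case: insubP => [s -> /= e|/negPf -> //].
  by rewrite ffunE [fsval s]e mulVKg yE.
have sub (Q : {set {ffun S -> A}}) :
    {in loc_patterns F E, forall f, q f \in Q} ->
    (#|restrict_to (trace i) @: loc_patterns F E| <= #|Q|)%N.
  move=> qQ; apply: leq_trans (leq_imset_card h _).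
  apply/subset_leq_card/fintype.subsetP => _ /imsetP[f fE ->].
  by rewrite hq imset_f // qQ.
case: ifPn => [_|]; last rewrite inE negbK => iT.
  apply: (leq_trans (sub [set: {ffun S -> A}]%SET _)).
    by move=> f _; rewrite finset.in_setT.
  by rewrite cardsT card_ffun cardfE leq_exp2r ?leq_maxr // -cardfE cardfs_gt0.
apply: sub => f; rewrite !inE => /asboolP/asboolP fE.
have -> : FinMap (q f) = restr (fun g => y f (fsval i * g)%g) S by [].
apply/asboolP/asboolP; apply: hT => k Fk kT.
apply: (fE k Fk); apply: appears_pat_trans kT _.
exists (fsval i) => t.
have tE : (fsval i * fsval t)%g \in E.
  by rewrite (fsubsetP iT) // mem_translate mulKg fsvalP.
rewrite in_fnd; congr Some; rewrite /restr ffunE.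
by rewrite -(yE f [` tE]%fset).
Qed.

Lemma card_loc_patterns_le (R : realType) : (#|exterior| < #|` E|)%N ->
  (#|loc_patterns F E| ^ #|` S| <=
   #|glob_patterns F S| ^ #|` E| * (C ^ #|` S|) ^ #|exterior|)%N.
Proof.
move=> extE.
have [s0 s0S] := fset0Pn _ S0.
(* For a center [i] outside [exterior], [i * s0] lies in [E] because [s0] is in [T]. *)
have iE : (#|~: exterior| <= #|` E|)%N.
  pose m (i : centers) := (fsval i * s0)%g.
  have minj : injective m by move=> i j /mulIg/val_inj.
  rewrite cardE -(size_map m); apply: uniq_leq_size.
    by rewrite map_inj_uniq ?enum_uniq.
  move=> _ /mapP[i + ->]; rewrite mem_enum !inE negbK => /fsubsetP; apply.
  by rewrite mem_translate mulKg (fsubsetP ST).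
(* A positive exponent is required when [glob_patterns F S] is empty: the product must then
   vanish. *)
have i0 : (0 < #|~: exterior|)%N.
  have : (#|` E| <= #|exterior| + #|~: exterior|)%N.
    have <- : #|` [fset (e * s0^-1)%g | e in E]%fset| = #|` E|.
      by rewrite card_imfset //; exact: mulIg.
    rewrite cardsC -cardfE.
    apply/fsubset_leq_card/fsubsetP => _ /imfsetP[e eE ->].
    by apply/imfset2P; exists e => //; exists s0.
  by move: extE; case: #|~: _| => // ; rewrite addn0 ltnNge => /negPf ->.
have := @shearer _ _ R _ trace #|` S| (loc_patterns F E) [set: E]%SET.
rewrite cardfs_gt0 => /(_ S0 (fun v _ => card_cover v)).
rewrite card_imset; last first.
  by move=> f g /restrict_toP fg; apply/ffunP => v; rewrite fg.
move=> /leq_trans; apply.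
under eq_bigr do rewrite finset.setIT.
apply: leq_trans (leq_prod (fun i _ => card_trace i)) _.
rewrite (bigID (mem exterior)) /= mulnC.
rewrite (eq_bigr (fun=> #|glob_patterns F S|)) => [|i /negPf-> //].
rewrite [X in (_ * X <= _)%N](eq_bigr (fun=> C ^ #|` S|)%N) => [|i -> //].
rewrite !prod_nat_const leq_mul //.
rewrite (eq_card (B := ~: exterior)) => [|i]; last by rewrite finset.in_setC.
have [->|g0] := posnP #|glob_patterns F S|; first by rewrite exp0n.
by rewrite leq_pexp2l.
Qed.

End Bound.
End Patterns.

(** * Følner sets and their inverses *)

Definition inv_fset (G : groupType) (D : {fset G}) : {fset G} :=
  [fset (d^-1)%g | d in D]%fset.

Lemma mem_inv_fset (G : groupType) (D : {fset G}) g :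
  (g \in inv_fset D) = (g^-1%g \in D).
Proof.
apply/imfsetP/idP => [[d dD ->]|gD]; first by rewrite invgK.
by exists g^-1%g; rewrite ?invgK.
Qed.

Lemma card_inv_fset (G : groupType) (D : {fset G}) : #|` inv_fset D| = #|` D|.
Proof. by rewrite card_imfset //; exact: invg_inj. Qed.

(** If [g = e * s^-1] and [g * t] leaves the inverse of [D], then [w = (g * t)^-1 = t^-1 * s * e^-1]
    lies in a left translate of [D] but not in [D], and [g = (t * w)^-1] is recovered from [t] and
    [w]. Inversion turns the right multiplications met here into the left translations of the Følner
    condition. *)
Lemma card_exterior_le (G : groupType) (S T D : {fset G}) :
  (#|exterior S T (inv_fset D)| <=
   \sum_(s <- S) \sum_(t <- T) #|` symdiff (translate (t^-1 * s) D) D|)%N.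
Proof.
pose r := [seq ((t.2 * w)^-1)%g | t <- [seq (s, t) | s <- S, t <- T],
                     w <- symdiff (translate (t.2^-1 * t.1) D) D].
have -> : (\sum_(s <- S) \sum_(t <- T)
    #|` symdiff (translate (t^-1 * s) D) D|)%N = size r.
  rewrite size_allpairs_dep sumnE big_map big_allpairs_dep.
  by apply: eq_bigr => s _; apply: eq_bigr.
rewrite cardE -(size_map (@fsval _ _)); apply: uniq_leq_size.
  by rewrite map_inj_uniq ?enum_uniq //; exact: val_inj.
move=> _ /mapP[i + ->]; rewrite mem_enum finset.in_set => /fsubsetPn[gt].
rewrite mem_translate mem_inv_fset; set t := ((fsval i)^-1 * gt)%g => tT gtD.
have /imfset2P[e + [s sS ie]] := fsvalP i; rewrite mem_inv_fset => eD.
have gtE : gt = (e * s^-1 * t)%g by rewrite /t -ie mulVKg.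
clearbody t.
apply/allpairsPdep; exists (s, t), gt^-1%g; split.
- by apply/allpairsP; exists (s, t).
- apply/fsetUP; left; rewrite in_fsetD gtD mem_translate /=.
  by rewrite gtE !invgM !invgK !mulgA mulgK mulVg mul1g.
- by rewrite /= invgM invgK gtE mulgK ie.
Qed.

Lemma Folner_card_cvg (R : realType) (G : groupType) (D : nat -> {fset G}) :
  infinite_set [set: G] -> Folner_sequence R D -> #|` D n| @[n --> \oo] --> \oo.
Proof.
move=> Ginf [D0 Dinv]; apply/cvgnyPge => m.
have [S Sm] := ex_fset_card Ginf m.
(* With fewer than [m] elements in [D n], a ratio below [1 / (m + 1)] forces an empty symmetric
   difference; then [D n] contains [S * d], which has [m] elements. *)
have : \forall n \near \oo, forall s : S,
    #|` symdiff (translate (fsval s) (D n)) (D n)|%:R / #|` D n|%:R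
      < (m.+1%:R^-1 : R).
  apply: filter_forall => s; apply: (cvgr_lt 0); first exact: Dinv.
  by rewrite invr_gt0 ltr0n.
apply: filterS => n small; rewrite leqNgt; apply/negP => Dm.
have Dn0 : (0 < #|` D n|)%N by rewrite cardfs_gt0.
have [d dD] := fset0Pn _ (D0 n).
suff : (m <= #|` D n|)%N by rewrite leqNgt Dm.
rewrite -Sm; have <- : #|` [fset (s * d)%g | s in S]%fset| = #|` S|.
  by rewrite card_imfset //; exact: mulIg.
apply/fsubset_leq_card/fsubsetP => _ /imfsetP[s /= sS ->].
have := small [` sS]%fset; rewrite /= ltr_pdivrMr ?ltr0n // mulrC.
rewrite ltr_pdivlMr ?ltr0n // -natrM ltr_nat => lt_sd.
have : (#|` symdiff (translate s (D n)) (D n)| == 0)%N.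
  rewrite -leqn0 -ltnS -(ltn_pmul2r (ltn0Sn m)) mul1n.
  by rewrite (ltn_trans lt_sd) // (ltn_trans Dm).
rewrite cardfs_eq0 => /eqP sd0; apply: contraT => sdD.
rewrite -(in_fset0 (s * d)%g) -sd0; apply/fsetUP; left.
by rewrite in_fsetD sdD mem_translate mulKg.
Qed.

(** * Comparison of the two growths *)

Section Growth.
Variables (R : realType) (G : groupType) (A : finType) (F : set {fmap G -> A}).
Hypothesis Ginf : infinite_set [set: G].

Lemma natmin_card_ex (N : {fset G} -> nat) n :
  exists2 S : {fset G}, #|` S| = n &
    N S = natmin [set N S | S in [set S : {fset G} | #|` S| = n]].
Proof.
have [S Sn] := ex_fset_card Ginf n.
have [|[T Tn eT] _] := @natminP
  [set N S | S in [set S : {fset G} | #|` S| = n]].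
  by exists (N S), S.
by exists T.
Qed.

Lemma natmin_card_le (N : {fset G} -> nat) (S : {fset G}) :
  (natmin [set N T | T in [set T : {fset G} | #|` T| = #|` S|]] <= N S)%N.
Proof.
have [|_] := @natminP [set N T | T in [set T : {fset G} | #|` T| = #|` S|]].
  by exists (N S), S.
by apply; exists S.
Qed.

Lemma glob_patterns_sub_loc (S : {fset G}) :
  glob_patterns F S \subset loc_patterns F S.
Proof.
apply/fintype.subsetP => p; rewrite !finset.in_set => /asboolP[x xF px].
apply/asboolP => f Ff fp; apply: (xF f Ff); exact: appears_pat_conf fp px.
Qed.

Lemma global_growth_le_local : global_growth R F <= local_growth R F.
Proof.
apply: (ler_cvg_to (f := root_seq R (Gmin F)) (g := root_seq R (Lmin F))
  (@Gmin_cvg R G A F Ginf) (@Lmin_cvg R G A F Ginf)).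
apply: nearW => n; rewrite /root_seq ge0_ler_powR ?nnegrE ?invr_ge0 ?ler0n //.
rewrite ler_nat /Gmin /Lmin.
have [S <- <-] := natmin_card_ex (fun S => #|loc_patterns F S|) n.
apply: leq_trans (subset_leq_card (glob_patterns_sub_loc S)).
exact: (natmin_card_le (fun S => #|glob_patterns F S|)).
Qed.

Lemma powR_cvg1 (c : R) (u : nat -> R) : 0 < c ->
  u @ \oo --> (0 : R) -> c `^ u n @[n --> \oo] --> (1 : R).
Proof.
move=> c0 u0.
have -> : (fun n => c `^ u n) = (fun n => expR (u n * ln c)).
  by apply/funext => n; rewrite /powR gt_eqF.
rewrite -expR0 -(mul0r (ln c)).
apply: continuous_cvg; first exact: continuous_expR.
by apply: cvgM => //; exact: cvg_cst.
Qed.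

Lemma local_growth_le_glob_patterns (S : {fset G}) :
  S != fset0 -> amenable R G ->
  local_growth R F <= #|glob_patterns F S|%:R `^ #|` S|%:R^-1.
Proof.
move=> S0 [D [D0 Dinv]].
have [T ST hT] := locally_globally_admissible F S.
have Dcard := Folner_card_cvg Ginf (conj D0 Dinv).
pose b n := #|exterior S T (inv_fset (D n))|.
pose C := maxn 1 #|A|.
have Dp n : (0 < #|` D n|)%N by rewrite cardfs_gt0.
have b0 : (b n)%:R / #|` D n|%:R @[n --> \oo] --> (0 : R).
  pose B n : R := \sum_(s <- S) \sum_(t <- T)
    #|` symdiff (translate (t^-1 * s) (D n)) (D n)|%:R / #|` D n|%:R.
  have B0 : B @ \oo --> (0 : R).
    rewrite (_ : 0 = \sum_(s <- S) \sum_(t <- T) 0); last first.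
      by rewrite big1 // => s _; rewrite big1.
    apply: cvg_big => [|s _]; first exact: add_continuous.
    by apply: cvg_big => [|t _]; [exact: add_continuous | exact: Dinv].
  apply: (squeeze_cvgr _ (cvg_cst 0) B0); apply: nearW => n.
  rewrite divr_ge0 //=; rewrite /B.
  under eq_bigr do rewrite -mulr_suml -natr_sum.
  rewrite -mulr_suml -natr_sum ler_pM2r ?invr_gt0 ?ltr0n // ler_nat.
  exact: card_exterior_le.
(* The limit is computed along the cardinalities of the Følner sets, which tend to infinity. *)
have cvgL : root_seq R (Lmin F) #|` D n| @[n --> \oo] --> local_growth R F.
  exact: (cvg_comp _ _ Dcard (@Lmin_cvg R G A F Ginf)).
have Cp : 0 < C%:R :> R by rewrite ltr0n leq_max.
have cvgR : #|glob_patterns F S|%:R `^ #|` S|%:R^-1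
    * C%:R `^ ((b n)%:R / #|` D n|%:R) @[n --> \oo]
    --> (#|glob_patterns F S|%:R `^ #|` S|%:R^-1 : R).
  rewrite -[X in _ --> X]mulr1; apply: cvgM; first exact: cvg_cst.
  exact: powR_cvg1.
apply: ler_cvg_to cvgL cvgR _.
have : \forall n \near \oo, (b n)%:R / #|` D n|%:R < (1 : R).
  by apply: (cvgr_lt 0).
apply: filterS => n; rewrite ltr_pdivrMr ?ltr0n // mul1r ltr_nat => bD.
have := card_loc_patterns_le S0 ST hT R (E := inv_fset (D n)).
rewrite card_inv_fset -/(b n) -/C => /(_ bD) bound.
have {bound} : (Lmin F #|` D n| ^ #|` S| <=
    #|glob_patterns F S| ^ #|` D n| * (C ^ #|` S|) ^ b n)%N.
  apply: leq_trans bound; rewrite leq_exp2r ?cardfs_gt0 //.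
  rewrite -card_inv_fset.
  exact: (natmin_card_le (fun S => #|loc_patterns F S|)).
rewrite /root_seq.
set l := Lmin _ _; set g := #|glob_patterns F S|; set d := #|` D n|.
set k := #|` S|.
have k0 : (k%:R : R) != 0 by rewrite pnatr_eq0 -lt0n cardfs_gt0.
have d0 : (d%:R : R) != 0 by rewrite pnatr_eq0 -lt0n Dp.
rewrite -expnM -(ler_nat R) natrM !natrX -!powR_mulrn // => bound.
(* The [(k * d)]-th root leaves the [k]-th root of [g] times [C] to the power [b n / d]. *)
have := ge0_ler_powR (r := (k%:R * d%:R)^-1) _ _ _ bound.
rewrite nnegrE powR_ge0 invr_ge0 mulr_ge0 // nnegrE mulr_ge0 ?powR_ge0 //.
move=> /(_ isT isT isT); rewrite powRM ?powR_ge0 // -!powRrM natrM.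
congr (_ `^ _ <= _ `^ _ * _ `^ _).
- by rewrite invfM mulrA divff // mul1r.
- by rewrite invfM mulrCA divff // mulr1.
- by rewrite invfM mulrACA divff // mul1r.
Qed.

End Growth.

Theorem theorem5 (R : realType) (G : groupType) (A : finType)
  (F : set {fmap G -> A})
  (G_countably_infinite : ([set: G] #= [set: nat])%card)
  (G_amenable : amenable R G)
  (F_patterns : F `<=` @patterns G A) :
  global_growth R F = local_growth R F.
Proof.
have Ginf : infinite_set [set: G].
  by rewrite (eq_finite_set G_countably_infinite); exact: infinite_nat.
apply/le_anti/andP; split; first exact: global_growth_le_local.
(* Each term with [n > 0] of the sequence defining the global growth already bounds the local
   growth, through a set [S] attaining the minimum. *)
apply: limr_ge; first exact: Gmin_cvg.
near=> n.
have [S Sn Gn] := natmin_card_ex Ginf (fun S => #|glob_patterns F S|) n.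
rewrite /root_seq /Gmin -Gn -Sn; apply: local_growth_le_glob_patterns => //.
by rewrite -cardfs_gt0 Sn; near: n; exact: nbhs_infty_gt.
Unshelve. all: by end_near. Qed.
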